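(* Let $\eta\in\mathbb C\setminus\{0\}$, $\lambda_1,\lambda_2,\delta_1,\delta_2\in\mathbb C$, $I=K_{\lambda_1}\times K_{\lambda_2}$, $g(x)=\delta_1-\delta_2+\eta(\lambda_1-\lambda_2+x)$, and assume $g(k-\ell-n)\ne0$ whenever $n\ge1$ and $(\ell,k),(\ell+n,k-n)\in I$. Let $q_{\ell k}\neq0$, $(\ell,k)\in I$, be arbitrary, $Q_{12}|\ell,k\rangle=q_{\ell k}^{-1}|\ell,k\rangle$, and let $(v_{\ell k})_{(\ell,k)\in I}$ be the basis of $V_{\lambda_1}(\delta_1)\otimes V_{\lambda_2}(\delta_2)$ given by $$v_{\ell k}=q_{\ell k}\sum_{n=0}^{k}\frac{(-\eta)^n}{n!}\Bigl(\prod_{j=1}^n\frac{f^{(1)}_{\ell+j-1}\,e^{(2)}_{k-j+1}}{g(k-\ell-j)}\Bigr)|\ell+n,k-n\rangle ,$$ which diagonalizes $\Delta D(u)$. Then the operator $$F_{12}=Q_{12}\sum_{n=0}^\infty\frac{\eta^n}{n!}\Bigl(\prod_{j=1}^n\bigl(\delta_1-\delta_2+\eta(H\otimes1-1\otimes H)+\eta j\bigr)^{-1}\Bigr)F^n\otimes E^n$$ is the inverse change of basis, i.e. $F_{12}$ is the inverse of the linear map $|\ell,k\rangle\mapsto v_{\ell k}$.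
   Context: For $\lambda\in\mathbb C$, $V_\lambda$ is the highest weight $\mathfrak{sl}_2$-representation with basis $|k\rangle$, $k\in K_\lambda$, where $K_\lambda=\{0,\dots,2\lambda\}$ if $2\lambda\in\mathbb N_0$ and $K_\lambda=\mathbb N_0$ otherwise, and $H|k\rangle=(\lambda-k)|k\rangle$, $E|k\rangle=k|k-1\rangle$, $F|k\rangle=(2\lambda-k)|k+1\rangle$; $|k\rangle:=0$ if $k\notin K_\lambda$. The evaluation representation $V_\lambda(\delta)$ of the Yangian is $V_\lambda$ with $B(u)=\eta F$, $C(u)=\eta E$, $D(u)=u-\delta-\eta H$, and on $V_{\lambda_1}(\delta_1)\otimes V_{\lambda_2}(\delta_2)$ one has $\Delta D(u)=B(u)\otimes C(u)+D(u)\otimes D(u)$ (the $j$-th factor uses $\lambda_j,\delta_j$). Notation: $e^{(j)}_k=k$, $f^{(j)}_k=2\lambda_j-k$, $|\ell,k\rangle=|\ell\rangle\otimes|k\rangle$, zero if $(\ell,k)\notin I$; terms of a sum whose basis vector is zero are omitted (so only finitely many terms of the operator sum act nontrivially on each vector). *)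

(* Defs.v *)
From HB Require Import structures.
From mathcomp Require Import all_boot all_order all_algebra.
From mathcomp Require Import complex freeg.
From mathcomp Require Import boolp classical_sets fsbigop reals ring.

Set Implicit Arguments.
Unset Strict Implicit.
Unset Printing Implicit Defensive.

Import GRing.Theory.
Local Open Scope ring_scope.

(* A space with basis indexed by [J] is the free module [{freeg J / C}]:
   [<< i >>] is the basis vector of index [i], [coeff i x] the coordinate of [x]
   at [i], and [fglift f] the linear map sending [<< i >>] to [f i]. *)

Section FreeModule.
Variable C : fieldType.

Section OneSpace.
Variable J : choiceType.
Implicit Type A : {freeg J / C} -> {freeg J / C}.

(* every vector is a unique finite linear combination of the [b i] *)
Definition is_basis (b : J -> {freeg J / C}) : Prop := bijective (fglift b).

Definition diagonalizes (b : J -> {freeg J / C}) A : Prop :=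
  is_basis b /\ forall i, exists c : C, A (b i) = c *: b i.

(* Inverse of an operator that is diagonal in the standard basis, taken
   eigenvalue by eigenvalue. Where an eigenvalue vanishes the value is junk
   (0^-1 = 0); lemma [shiftopK] below shows this never occurs in [F12]. *)
Definition diag_inv A : {freeg J / C} -> {freeg J / C} :=
  fglift (fun i => (coeff i (A << i >>))^-1 *: << i >>).

End OneSpace.

Section Linear.
Variables (J : choiceType) (M : lmodType C) (f : J -> M).

Lemma freegUZ (c : C) (i : J) : << c *g i >> = c *: << i >> :> {freeg J / C}.
Proof. by apply/eqP/freeg_eqP => z; rewrite coeffZ !coeffU mul1r. Qed.

Lemma fgliftU i : fglift f << i >> = f i.
Proof. by rewrite liftU scale1r. Qed.

Lemma fglift_linear : linear (fglift f).
Proof.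
have fB : {morph fglift f : x y / x - y} by exact: lift_is_additive.
have f0 : fglift f 0 = 0 by rewrite -[X in fglift f X](subrr 0) fB subrr.
have fD : {morph fglift f : x y / x + y}.
  by move=> x y; rewrite -[y in LHS]opprK -[- y]sub0r !fB f0 sub0r opprK.
move=> c x y; rewrite fD; congr (_ + _).
rewrite -(freeg_sumE x) scaler_sumr !(big_morph _ fD f0) scaler_sumr.
apply: eq_bigr => i _.
by rewrite freegUZ scalerA -!freegUZ !liftU scalerA.
Qed.

HB.instance Definition _ :=
  GRing.isLinear.Build C {freeg J / C} M *:%R (fglift f) fglift_linear.

Lemma fgliftD x y : fglift f (x + y) = fglift f x + fglift f y.
Proof. exact: linearD. Qed.

Lemma fglift0 : fglift f 0 = 0.
Proof. exact: linear0. Qed.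

Lemma fgliftZ (c : C) x : fglift f (c *: x) = c *: fglift f x.
Proof. exact: linearZ. Qed.

Lemma fglift_sum (T : Type) (r : seq T) (X : T -> {freeg J / C}) :
  fglift f (\sum_(t <- r) X t) = \sum_(t <- r) fglift f (X t).
Proof. exact: linear_sum. Qed.

Lemma freeg_decomp (x : {freeg J / C}) :
  x = \sum_(i <- dom x) coeff i x *: << i >>.
Proof. by rewrite -[LHS]freeg_sumE; apply: eq_bigr => i _; rewrite freegUZ. Qed.

End Linear.

(* The tensor product of free modules is the free module on pairs,
   with << a >> (x) << b >> = << (a, b) >>. *)
Definition tens (J1 J2 : choiceType)
    (x : {freeg J1 / C}) (y : {freeg J2 / C}) : {freeg (J1 * J2)%type / C} :=
  fglift (fun a => fglift (fun b => << (a, b) >> : {freeg (J1 * J2)%type / C}) y) x.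

Definition otimes (J1 J2 : choiceType)
    (A : {freeg J1 / C} -> {freeg J1 / C}) (B : {freeg J2 / C} -> {freeg J2 / C}) :
    {freeg (J1 * J2)%type / C} -> {freeg (J1 * J2)%type / C} :=
  fglift (fun i => tens (A << i.1 >>) (B << i.2 >>)).

End FreeModule.

Section Sl2.
Variable R : realType.
Local Notation C := R[i].
Implicit Types la eta de u : C.

(* {0, ..., 2 la} if 2 la is a natural number, all of nat otherwise *)
Definition K la : pred nat :=
  fun k => `[< forall m : nat, 2 * la = m%:R -> (k <= m)%N >].

Local Notation idx la := {k : nat | K la k}.
Local Notation V la := {freeg (idx la) / C}.
Local Notation V2 la1 la2 := {freeg (idx la1 * idx la2)%type / C}.

Definition ket la (k : nat) : V la :=
  if insub k : option (idx la) is Some i then << i >> else 0.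

Definition ket2 la1 la2 (l k : nat) : V2 la1 la2 := tens (ket la1 l) (ket la2 k).

Definition ecoef (k : nat) : C := k%:R.
Definition fcoef la (k : nat) : C := 2 * la - k%:R.

Definition opH la : V la -> V la :=
  fglift (fun i : idx la => (la - (val i)%:R) *: ket la (val i)).
(* for k = 0 the coefficient is 0, so the value of 0.-1 is irrelevant *)
Definition opE la : V la -> V la :=
  fglift (fun i : idx la => ecoef (val i) *: ket la (val i).-1).
Definition opF la : V la -> V la :=
  fglift (fun i : idx la => fcoef la (val i) *: ket la (val i).+1).

Definition evB eta la (x : V la) : V la := eta *: opF x.
Definition evC eta la (x : V la) : V la := eta *: opE x.
Definition evD eta la de u (x : V la) : V la := u *: x - de *: x - eta *: opH x.

Section TwoSites.
Variables eta la1 la2 de1 de2 : C.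
Local Notation W := (V2 la1 la2).

Definition DeltaD u (x : W) : W :=
  otimes (@evB eta la1) (@evC eta la2) x
  + otimes (@evD eta la1 de1 u) (@evD eta la2 de2 u) x.

Definition g (x : C) : C := de1 - de2 + eta * (la1 - la2 + x).

Section Basis.
Variable q : idx la1 * idx la2 -> C.

(* Where [ket2 (l + n) (k - n)] is zero the denominators may vanish; such terms
   contribute 0 whatever the value of the coefficient. *)
Definition vvec (i : idx la1 * idx la2) : W :=
  let l := val i.1 in let k := val i.2 in
  q i *: \sum_(0 <= n < k.+1)
    ((- eta) ^+ n / (n`!)%:R *
     \prod_(1 <= j < n.+1)
        (fcoef la1 (l + j - 1) * ecoef (k - j + 1) / g (k%:R - l%:R - j%:R)))
    *: ket2 la1 la2 (l + n) (k - n).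

Definition Q12 : W -> W := fglift (fun i => (q i)^-1 *: << i >>).

(* de1 - de2 + eta (H (x) 1 - 1 (x) H) + eta j *)
Definition shiftop (j : nat) (x : W) : W :=
  (de1 - de2) *: x + eta *: (otimes (@opH la1) idfun x - otimes idfun (@opH la2) x)
  + (eta * j%:R) *: x.

(* n-th term of the operator series, before applying [Q12] *)
Definition F12term (n : nat) (x : W) : W :=
  (eta ^+ n / (n`!)%:R) *:
    (\big[comp/idfun]_(1 <= j < n.+1) diag_inv (shiftop j))
      (otimes (iter n (@opF la1)) (iter n (@opE la2)) x).

(* The series is locally finite (lemma [F12term_finite] below), and
   [\sum_(n \in A)] is the sum over the indices with nonzero term. *)
Definition F12 (x : W) : W := Q12 (\sum_(n \in [set: nat]) F12term n x).

End Basis.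

Lemma K_le la (k k' : nat) : (k' <= k)%N -> K la k -> K la k'.
Proof.
move=> lek /asboolP Kk; apply/asboolP => m /Kk; exact: leq_trans.
Qed.

Lemma ketT la (k : nat) (Kk : K la k) : ket la k = << exist _ k Kk >>.
Proof. by rewrite /ket insubT. Qed.

Lemma ketF la (k : nat) : ~~ K la k -> ket la k = 0.
Proof. by move=> Kk; rewrite /ket insubN. Qed.

Lemma iter_opF la n (i : idx la) :
  exists c : C, iter n (@opF la) << i >> = c *: ket la (val i + n).
Proof.
elim: n => [|n [c IH]]; first by exists 1; rewrite addn0 scale1r /ket valK.
have [Kn|Kn] := boolP (K la (val i + n)).
  exists (c * fcoef la (val i + n)).
  by rewrite iterS IH /opF fgliftZ ketT fgliftU scalerA addnS.
by exists 0; rewrite iterS IH ketF // /opF scaler0 fglift0 scale0r.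
Qed.

Lemma iter_opE la n (i : idx la) :
  exists c : C, iter n (@opE la) << i >> = c *: ket la (val i - n)
    /\ ((val i < n)%N -> c = 0).
Proof.
elim: n => [|n [c [IH c0]]]; first by exists 1; rewrite subn0 scale1r /ket valK.
have Kn : K la (val i - n)%N by apply: K_le (valP i); exact: leq_subr.
exists (c * ecoef (val i - n)); split.
  by rewrite iterS IH /opE fgliftZ ketT fgliftU scalerA subnS.
by rewrite ltnS -subn_eq0 => /eqP ->; rewrite /ecoef mulr0.
Qed.

Lemma otimes_FE n (i : idx la1 * idx la2) :
  otimes (iter n (@opF la1)) (iter n (@opE la2)) << i >> = 0 :> W \/
  (n <= val i.2)%N /\ exists c : C, exists p : idx la1 * idx la2,
    [/\ val p.1 = (val i.1 + n)%N, val p.2 = (val i.2 - n)%N &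
        otimes (iter n (@opF la1)) (iter n (@opE la2)) << i >> = c *: << p >> :> W].
Proof.
rewrite /otimes fgliftU.
have [c1 ->] := iter_opF n i.1; have [c2 [-> c20]] := iter_opE n i.2.
have K2 : K la2 (val i.2 - n)%N by apply: K_le (valP i.2); exact: leq_subr.
rewrite /tens fgliftZ.
have [K1|K1] := boolP (K la1 (val i.1 + n)); last first.
  by left; rewrite (ketF K1) fglift0 scaler0.
rewrite (ketT K1) fgliftU (ketT K2) fgliftZ fgliftU scalerA.
have [lt|le] := ltnP (val i.2) n.
  by left; rewrite (c20 lt) mulr0 scale0r.
by right; split=> //; exists (c1 * c2), (exist (fun k => K la1 k) _ K1, exist (fun k => K la2 k) _ K2).
Qed.

Lemma F12term_finite (x : W) :
  exists N : nat, forall n, (N <= n)%N -> F12term n x = 0.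
Proof.
exists (\max_(i <- dom x) (val i.2).+1)%N => n leNn.
have pinv0 : (\big[comp/idfun]_(1 <= j < n.+1) diag_inv (shiftop j)) 0 = 0 :> W.
  by elim/big_rec: _ => // j f _ /= ->; rewrite /diag_inv fglift0.
rewrite /F12term (_ : otimes _ _ x = 0) ?pinv0 ?scaler0 //.
rewrite (freeg_decomp x) /otimes fglift_sum big_seq big1 // => i xi.
have := otimes_FE n i; rewrite /otimes fgliftZ => -[->|[le _]].
  by rewrite scaler0.
have : ((val i.2).+1 <= \max_(i <- dom x) (val i.2).+1)%N.
  by apply: leq_bigmax_seq.
by move=> /leq_trans /(_ leNn); rewrite ltnNge le.
Qed.

Lemma shiftopE j (p : idx la1 * idx la2) :
  shiftop j << p >> = g ((val p.2)%:R - (val p.1)%:R + j%:R) *: << p >> :> W.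
Proof.
have kp la (i : idx la) : ket la (val i) = << i >> by rewrite /ket valK.
rewrite /shiftop /otimes !fgliftU /= /opH !fgliftU !kp /tens.
rewrite !fgliftZ !fgliftU fgliftZ !fgliftU -surjective_pairing.
rewrite -scalerBl scalerA -!scalerDl; congr (_ *: _); rewrite /g.
ring.
Qed.

(* On the range of F^n (x) E^n the inverses in [F12term n] are genuine. *)
Lemma shiftopK
    (g_neq0 : forall l k n : nat, (1 <= n <= k)%N ->
       K la1 l -> K la2 k -> K la1 (l + n)%N -> K la2 (k - n)%N ->
       g (k%:R - l%:R - n%:R) != 0)
    (n j : nat) (x : W) : (1 <= j <= n)%N ->
  let y := otimes (iter n (@opF la1)) (iter n (@opE la2)) x in
  shiftop j (diag_inv (shiftop j) y) = y
  /\ diag_inv (shiftop j) (shiftop j y) = y.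
Proof.
move=> /andP[j1 jn] /=.
have sZ c z : shiftop j (c *: z) = c *: shiftop j z :> W.
  rewrite /shiftop /otimes !fgliftZ -scalerBr !scalerDr !scalerA.
  by rewrite ![_ * c]mulrC.
have sD y z : shiftop j (y + z) = shiftop j y + shiftop j z :> W.
  rewrite /shiftop /otimes !fgliftD opprD [X in eta *: X]addrACA !scalerDr.
  by rewrite [X in X + _ = _]addrACA [LHS]addrACA -!scalerDr.
have s0 : shiftop j 0 = 0 :> W by have := sZ 0 0; rewrite !scale0r.
have IS y z : diag_inv (shiftop j) (y + z) =
    diag_inv (shiftop j) y + diag_inv (shiftop j) z by exact: fgliftD.
have IZ c z : diag_inv (shiftop j) (c *: z) = c *: diag_inv (shiftop j) z.
  exact: fgliftZ.
have -> : otimes (iter n (@opF la1)) (iter n (@opE la2)) x =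
    \sum_(i <- dom x) coeff i x *:
      otimes (iter n (@opF la1)) (iter n (@opE la2)) << i >> :> W.
  rewrite {1}(freeg_decomp x) /otimes fglift_sum.
  by apply: eq_bigr => i _; rewrite fgliftZ.
elim: (dom x) => [|i r [IH1 IH2]].
  by rewrite big_nil s0 /diag_inv fglift0 s0.
rewrite big_cons IS !sD IS IH1 IH2 IZ !sZ IZ.
case: (otimes_FE n i) => [->|[le [c [p [p1 p2 ->]]]]].
  by rewrite s0 /diag_inv fglift0 s0.
rewrite IZ !sZ IZ shiftopE IZ.
have -> : diag_inv (shiftop j) << p >> =
    (g ((val p.2)%:R - (val p.1)%:R + j%:R))^-1 *: << p >> :> W.
  by rewrite /diag_inv fgliftU shiftopE coeffZ coeffU mul1r eqxx mulr1.
rewrite sZ shiftopE !scalerA.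
suff g0 : g ((val p.2)%:R - (val p.1)%:R + j%:R) != 0.
  by rewrite mulfVK // mulfK.
have leji : (j <= val i.2 - n + j)%N by exact: leq_addl.
have /g_neq0 : (1 <= j <= val i.2 - n + j)%N by rewrite j1.
move=> /(_ (val i.1 + n - j)%N).
have jin : (j <= val i.1 + n)%N by rewrite (leq_trans jn) ?leq_addl.
rewrite subnK // addnK -p1 -p2.
rewrite (_ : _ - _ - _ = (val p.2)%:R - (val p.1)%:R + j%:R :> C); last first.
  rewrite natrB ?p1 // natrD opprB.
  by rewrite addrAC addrA addrK addrAC.
apply.
- by apply: K_le (valP p.1); exact: leq_subr.
- apply: K_le (valP i.2); rewrite p2.
  by rewrite -[leqRHS](subnK le) leq_add2l.
- exact: valP.
- exact: valP.
Qed.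

End TwoSites.
End Sl2.

Notation idx la := {k : nat | K la k}.

(* Main.v *)
(* Both the map V : |l, k> -> v_{l k} and the operator F12 preserve the finite
   strips {|l + n, k - n>}. On a strip, F12 V = 1 reduces for each N > 0 to the
   vanishing of an N-th finite difference of a product of N - 1 consecutive
   values of g, a polynomial of degree N - 1. Since V is triangular with nonzero
   diagonal q, it is surjective, and F12 V = 1 then gives V F12 = 1. *)
Require Import Defs.
From HB Require Import structures.
From mathcomp Require Import all_boot all_order all_algebra.
From mathcomp Require Import complex freeg reals.
From mathcomp Require Import fsbigop ring zify.

Set Implicit Arguments.
Unset Strict Implicit.
Unset Printing Implicit Defensive.

Import GRing.Theory Num.Theory.
Local Open Scope ring_scope.

(** * Alternating binomial sums and finite differences *)

Section FiniteDifferences.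

(** Pascal's rule, with one half shifted by an index; it drives an induction on the order of the
    difference. *)
Lemma sum_alt_binS (F : comNzRingType) (N : nat) (h : nat -> F) :
  \sum_(0 <= n < N.+2) (-1) ^+ n * 'C(N.+1, n)%:R * h n =
  \sum_(0 <= n < N.+1) (-1) ^+ n * 'C(N, n)%:R * (h n - h n.+1).
Proof.
rewrite big_nat_recl // bin0 expr0 !mul1r.
under eq_bigr do rewrite binS natrD mulrDr mulrDl.
rewrite big_split /=.
under [RHS]eq_bigr do rewrite mulrBr.
rewrite sumrB addrA; congr (_ + _).
  rewrite [X in _ + X]big_nat_recr //= bin_small // mulr0 mul0r addr0.
  by rewrite [RHS]big_nat_recl // bin0 expr0 !mul1r.
rewrite -sumrN; apply: eq_bigr => n _.
by rewrite exprS mulN1r !mulNr.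
Qed.

(** Two successive windows of [r + 1] factors share [r] of them, so they differ by [e * (r + 1)]
    times a window of length [r] that starts one later. Hence [a] stays general in the induction on
    [N]. *)
Lemma sum_alt_bin_prod (F : comNzRingType) (y e : F) (N r a : nat) :
  (r < N)%N ->
  \sum_(0 <= n < N.+1) (-1) ^+ n * 'C(N, n)%:R *
    \prod_(a + n <= j < a + n + r) (y - e * j%:R) = 0.
Proof.
elim: N r a => // N IH [|r] a ltrN; rewrite sum_alt_binS.
  apply: big1 => n _; rewrite !big_geq ?addn0 //.
  by rewrite subrr mulr0.
transitivity (e * r.+1%:R * \sum_(0 <= n < N.+1) (-1) ^+ n * 'C(N, n)%:R *
    \prod_(a.+1 + n <= j < a.+1 + n + r) (y - e * j%:R)); last first.
  by rewrite IH ?mulr0.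
rewrite mulr_sumr; apply: eq_bigr => n _.
rewrite [X in _ * (X - _)]big_ltn; last lia.
rewrite [(a + n.+1 + r.+1)%N]addnS [X in _ * (_ - X)]big_nat_recr /=; last lia.
rewrite (_ : (a + n.+1 + r = a + n + r.+1)%N); last lia.
rewrite (_ : (a.+1 + n + r = a + n + r.+1)%N); last lia.
rewrite (_ : (a.+1 + n = a + n.+1)%N); last lia.
rewrite !addnS -[(a + n + r).+1]addn1 -[r.+1]addn1 !natrD; ring.
Qed.

(* Over the common denominator, the n-th summand keeps the N - 1 consecutive
   factors of indices n + 1, ..., n + N - 1: a polynomial in n of degree N - 1,
   whose N-th finite difference vanishes. *)
Lemma sum_alt_fact_prodV (F : numFieldType) (y e : F) (N : nat) :
    (0 < N)%N ->
    (forall j, (0 < j < N + N)%N -> y - e * j%:R != 0) ->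
  \sum_(0 <= n < N.+1)
    (((- e) ^+ n / (n`!)%:R * (\prod_(1 <= j < n.+1) (y - e * j%:R))^-1) *
     (e ^+ (N - n) / ((N - n)`!)%:R *
        (\prod_(n + N <= j < N + N) (y - e * j%:R))^-1)) = 0.
Proof.
case: N => // N _ w_neq0; pose w j : F := y - e * j%:R.
have prod_neq0 a b : (0 < a)%N -> (b <= N.+1 + N.+1)%N ->
    \prod_(a <= j < b) w j != 0.
  move=> a0 bN; rewrite prodf_seq_neq0; apply/allP => j.
  by rewrite mem_index_iota => jab; apply: w_neq0; lia.
have fact_neq0 n : (n`!)%:R != 0 :> F by rewrite pnatr_eq0 -lt0n fact_gt0.
transitivity (e ^+ N.+1 / (N.+1`!)%:R / \prod_(1 <= j < N.+1 + N.+1) w j *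
    \sum_(0 <= n < N.+2) (-1) ^+ n * 'C(N.+1, n)%:R *
      \prod_(1 + n <= j < 1 + n + N) w j); last first.
  by rewrite sum_alt_bin_prod ?mulr0.
rewrite mulr_sumr [LHS]big_nat [RHS]big_nat; apply: eq_bigr => n /andP[_ ltn].
have leN : (n <= N.+1)%N by [].
(* Here [N] is one less than in the statement. The outer two blocks are the denominators of the
   summand; the middle block of [N] factors remains in the numerator. *)
rewrite (_ : \prod_(1 <= j < N.+1 + N.+1) w j = \prod_(1 <= j < n.+1) w j *
   \prod_(1 + n <= j < 1 + n + N) w j * \prod_(n + N.+1 <= j < N.+1 + N.+1) w j);
   last first.
  rewrite (@big_cat_nat _ _ _ n.+1) /=; [|lia|lia].
  rewrite (@big_cat_nat _ _ _ (n + N.+1)%N n.+1) /=; [|lia|lia].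
  by rewrite mulrA; do 2 f_equal; congr bigop; congr index_iota; lia.
have -> : e ^+ N.+1 = e ^+ n * e ^+ (N.+1 - n) by rewrite -exprD subnKC.
rewrite -(bin_fact leN) !natrM (exprNn e).
have := prod_neq0 1%N n.+1 isT; have := prod_neq0 (1 + n)%N (1 + n + N)%N isT.
have := prod_neq0 (n + N.+1)%N (N.+1 + N.+1)%N.
set A := \prod_(1 <= j < n.+1) w j; set B := \prod_(_ <= j < 1 + n + N) w j.
set D := \prod_(n + N.+1 <= j < N.+1 + N.+1) w j.
move=> D0 B0 A0.
have {}A0 : A != 0 by apply: A0; lia.
have {}B0 : B != 0 by apply: B0; lia.
have {}D0 : D != 0 by apply: D0; lia.
have bin0 : ('C(N.+1, n))%:R != 0 :> F by rewrite pnatr_eq0 -lt0n bin_gt0.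
move: (fact_neq0 n) (fact_neq0 (N.+1 - n)%N) A0 B0 D0 bin0 => ??????.
by field; do ?[apply/andP; split].
Qed.

End FiniteDifferences.

(** * Scalars and zeros in tensor products *)

Section Tensors.
Variables (C : fieldType) (J1 J2 : choiceType).
Implicit Types (x : {freeg J1 / C}) (y : {freeg J2 / C}).

Lemma tens_scale (a b : C) x y : tens (a *: x) (b *: y) = (a * b) *: tens x y.
Proof.
rewrite /tens fgliftZ -scalerA; congr (_ *: _).
rewrite (freeg_decomp x) !fglift_sum scaler_sumr; apply: eq_bigr => i _.
by rewrite !fgliftZ !fgliftU fgliftZ scalerA mulrC -scalerA.
Qed.

Lemma tens0l y : tens (0 : {freeg J1 / C}) y = 0.
Proof. exact: fglift0. Qed.

Lemma tens0r x : tens x (0 : {freeg J2 / C}) = 0.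
Proof. by have := tens_scale 1 0 x 0; rewrite mulr0 !scale0r scale1r. Qed.

End Tensors.

(** * Action of the operators on basis vectors *)

Section Kets.
Variable R : realType.
Local Notation C := R[i].
Implicit Types la : C.

Lemma ket_val la (i : idx la) : ket la (val i) = << i >>.
Proof. by rewrite /ket valK. Qed.

Lemma opF_ket la l : opF (ket la l) = fcoef la l *: ket la l.+1.
Proof.
have [Kl|Kl] := boolP (K la l); first by rewrite (ketT Kl) /opF fgliftU.
rewrite !ketF /opF ?fglift0 ?scaler0 //.
by apply: contra Kl; apply: K_le.
Qed.

Lemma iter_opF_ket la l n :
  iter n (@opF R la) (ket la l) =
  (\prod_(0 <= j < n) fcoef la (l + j)) *: ket la (l + n).
Proof.
elim: n => [|n IH]; first by rewrite big_geq // scale1r addn0.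
rewrite iterS IH big_nat_recr //= {1}/opF fgliftZ -/(opF _) opF_ket.
by rewrite scalerA addnS.
Qed.

(** Unlike for [opF], membership matters: just above the top of a finite [K la] the left side is
    zero and the right side is not. *)
Lemma opE_ket la k : K la k -> opE (ket la k) = ecoef R k *: ket la k.-1.
Proof. by move=> Kk; rewrite {1}ketT /opE fgliftU. Qed.

Lemma iter_opE_ket la k n : K la k ->
  iter n (@opE R la) (ket la k) =
  (\prod_(0 <= j < n) ecoef R (k - j)) *: ket la (k - n).
Proof.
move=> Kk; elim: n => [|n IH]; first by rewrite big_geq // scale1r subn0.
have Kn : K la (k - n)%N by apply: K_le Kk; exact: leq_subr.
rewrite iterS IH big_nat_recr //= {1}/opE fgliftZ -/(opE _) opE_ket //.
by rewrite scalerA subnS.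
Qed.

Variables la1 la2 : C.
Local Notation W := {freeg (idx la1 * idx la2)%type / C}.

Lemma ket2T l k (Kl : K la1 l) (Kk : K la2 k) :
  ket2 la1 la2 l k = << (exist _ l Kl, exist _ k Kk) >>.
Proof. by rewrite /ket2 !ketT /tens !fgliftU. Qed.

Lemma ket2_val (i : idx la1 * idx la2) :
  ket2 la1 la2 (val i.1) (val i.2) = << i >>.
Proof. by rewrite /ket2 !ket_val /tens !fgliftU -surjective_pairing. Qed.

Lemma ket2F l k : ~~ (K la1 l && K la2 k) -> ket2 la1 la2 l k = 0.
Proof.
rewrite negb_and => /orP[] nK; rewrite /ket2 (ketF nK).
  exact: tens0l.
exact: tens0r.
Qed.

Lemma otimes_ket2 A B l k : K la1 l -> K la2 k ->
  otimes A B (ket2 la1 la2 l k) = tens (A (ket la1 l)) (B (ket la2 k)).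
Proof. by move=> Kl Kk; rewrite ket2T /otimes fgliftU /= -!ketT. Qed.

(** Matrix entry of [F^n (x) E^n] from [(l, k)] to [(l + n, k - n)]. *)
Definition acoef l k n : C :=
  \prod_(0 <= j < n) (fcoef la1 (l + j) * ecoef R (k - j)).

Lemma otimes_iterFE_ket2 l k n : K la1 l -> K la2 k ->
  otimes (iter n (@opF R la1)) (iter n (@opE R la2)) (ket2 la1 la2 l k) =
  acoef l k n *: ket2 la1 la2 (l + n) (k - n).
Proof.
move=> Kl Kk; rewrite otimes_ket2 // iter_opF_ket iter_opE_ket // tens_scale.
by rewrite -big_split.
Qed.

(** * Matrix entries and linearity of [F12] *)

Variables eta de1 de2 : C.
Local Notation g := (g eta la1 la2 de1 de2).

(** Where this value of [g] vanishes, both sides are zero because [0^-1 = 0]. *)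
Lemma diag_inv_shiftop_ket2 j l k :
  diag_inv (shiftop eta de1 de2 j) (ket2 la1 la2 l k) =
  (g (k%:R - l%:R + j%:R))^-1 *: ket2 la1 la2 l k.
Proof.
have [/andP[Kl Kk]|nK] := boolP (K la1 l && K la2 k); last first.
  by rewrite (ket2F nK) scaler0 /diag_inv fglift0.
by rewrite ket2T /diag_inv fgliftU shiftopE /= coeffZ coeffU mul1r eqxx mulr1.
Qed.

(** Matrix entry of the [n]-th term of the series. The inverses act after [F^n (x) E^n], so [g] is
    taken at the target [(l + n, k - n)]. *)
Definition Fcoef l k n : C := eta ^+ n / (n`!)%:R * acoef l k n /
  \prod_(1 <= j < n.+1) g ((k - n)%:R - (l + n)%:R + j%:R).

Lemma F12term_ket2 l k n : K la1 l -> K la2 k ->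
  F12term eta de1 de2 n (ket2 la1 la2 l k) =
  Fcoef l k n *: ket2 la1 la2 (l + n) (k - n).
Proof.
move=> Kl Kk; rewrite /F12term otimes_iterFE_ket2 //.
set a := acoef l k n; set b := ket2 _ _ _ _.
have -> : (\big[comp/idfun]_(1 <= j < n.+1) diag_inv (shiftop eta de1 de2 j)) (a *: b) =
    (a * \prod_(1 <= j < n.+1) (g ((k - n)%:R - (l + n)%:R + j%:R))^-1) *: b.
  elim/big_rec2: _ => [|j f y _ /= ->]; first by rewrite mulr1.
  by rewrite {1}/diag_inv fgliftZ -/(diag_inv _ _) diag_inv_shiftop_ket2 scalerA
     -mulrA; congr ((_ * _) *: _); exact: mulrC.
by rewrite scalerA prodfV !mulrA.
Qed.

Lemma F12term_linear n : linear (F12term eta de1 de2 n : W -> W).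
Proof.
move=> c x y; rewrite /F12term /otimes fgliftD fgliftZ.
set X := fglift _ x; set Y := fglift _ y.
have -> : (\big[comp/idfun]_(1 <= j < n.+1) diag_inv (shiftop eta de1 de2 j)) (c *: X + Y) =
   c *: (\big[comp/idfun]_(1 <= j < n.+1) diag_inv (shiftop eta de1 de2 j)) X
   + (\big[comp/idfun]_(1 <= j < n.+1) diag_inv (shiftop eta de1 de2 j)) Y.
  elim/big_rec: _ => //= j f _ ->.
  by rewrite {1}/diag_inv fgliftD fgliftZ.
by rewrite scalerDr !scalerA mulrC.
Qed.

Variable q : idx la1 * idx la2 -> C.

Lemma F12_trunc N (x : W) : (forall n, (N <= n)%N -> F12term eta de1 de2 n x = 0) ->
  F12 eta de1 de2 q x = Q12 q (\sum_(0 <= n < N) F12term eta de1 de2 n x).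
Proof.
move=> F0; rewrite /F12; congr (Q12 q _).
rewrite big_mkord (fsbig_ord _ N (fun n => F12term eta de1 de2 n x)).
apply/esym/fsbig_widen => // n [_ /= /negP].
by rewrite -leqNgt => /F0.
Qed.

Lemma F12_linear : linear (F12 eta de1 de2 q : W -> W).
Proof.
move=> c x y.
have [Nx Fx] := F12term_finite eta de1 de2 x.
have [Ny Fy] := F12term_finite eta de1 de2 y.
(* One bound truncates the series for [x], [y] and [c *: x + y] alike. *)
rewrite !(@F12_trunc (maxn Nx Ny)) => [|n|n|n].
- rewrite /Q12 -fgliftZ -fgliftD scaler_sumr -big_split /=; congr fglift.
  by apply: eq_bigr => n _; rewrite F12term_linear.
- by rewrite geq_max => /andP[_ /Fy].
- by rewrite geq_max => /andP[/Fx].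
- by rewrite geq_max F12term_linear => /andP[/Fx -> /Fy ->]; rewrite scaler0 addr0.
Qed.

HB.instance Definition _ := GRing.isLinear.Build C W W *:%R
  (F12 eta de1 de2 q) F12_linear.

Lemma F12_ket2 l k : K la2 k ->
  F12 eta de1 de2 q (ket2 la1 la2 l k) =
  Q12 q (\sum_(0 <= n < k.+1) Fcoef l k n *: ket2 la1 la2 (l + n) (k - n)).
Proof.
move=> Kk; have [Kl|nKl] := boolP (K la1 l); last first.
  rewrite ket2F ?(negPf nKl) // linear0 big1 ?/Q12 ?fglift0 // => n _.
  rewrite ket2F ?scaler0 // negb_and; apply/orP; left; apply: contra nKl.
  by apply: K_le; exact: leq_addr.
rewrite (@F12_trunc k.+1) => [|n ltkn].
  by congr (Q12 q _); apply: eq_bigr => n _; rewrite F12term_ket2.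
rewrite F12term_ket2 // /Fcoef (_ : acoef l k n = 0) ?mulr0 ?mul0r ?scale0r //.
(* As [n > k], the factor of index [k] occurs, and it contains [ecoef 0 = 0]. *)
apply/eqP; rewrite prodf_seq_eq0; apply/hasP; exists k => /=.
  by rewrite mem_index_iota.
by rewrite subnn /ecoef mulr0.
Qed.

(** * Coefficients along a strip *)

Lemma acoefD l k n m : acoef l k (n + m) = acoef l k n * acoef (l + n) (k - n) m.
Proof.
rewrite /acoef (@big_cat_nat _ _ _ n) ?leq_addr //=; congr (_ * _).
rewrite -{1}[n]add0n big_addn addKn; apply: eq_bigr => j _.
by congr (fcoef _ _ * ecoef _ _); lia.
Qed.

Definition vcoef l k n : C := (- eta) ^+ n / (n`!)%:R *
  \prod_(1 <= j < n.+1)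
    (fcoef la1 (l + j - 1) * ecoef R (k - j + 1) / g (k%:R - l%:R - j%:R)).

Lemma vvecE i : vvec eta de1 de2 q i =
  q i *: \sum_(0 <= n < (val i.2).+1) vcoef (val i.1) (val i.2) n
    *: ket2 la1 la2 (val i.1 + n) (val i.2 - n).
Proof. by []. Qed.

Lemma gB (x : C) (j : nat) : g (x - j%:R) = g x - eta * j%:R.
Proof. by rewrite /Defs.g addrA mulrBr addrA. Qed.

(** Together with [FcoefE], this turns all denominators into values [g (k - l) - eta * j], the form
    that [sum_alt_fact_prodV] requires. *)
Lemma vcoefE l k n : (n <= k)%N -> vcoef l k n =
  acoef l k n * ((- eta) ^+ n / (n`!)%:R *
    (\prod_(1 <= j < n.+1) (g (k%:R - l%:R) - eta * j%:R))^-1).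
Proof.
move=> lenk; rewrite /vcoef big_split /= prodfV mulrCA; congr (_ * (_ / _)).
  rewrite big_add1 /=; apply: eq_big_nat => j /andP[_ ltjn].
  by congr (fcoef _ _ * ecoef _ _); lia.
by apply: eq_bigr => j _; rewrite gB.
Qed.

(** The target is [(l + N, k - N)], where [g] has arguments [k - l - (2N - j)] for
    [1 <= j <= N - n]; reversing the order gives the indices [n + N, ..., 2N - 1]. *)
Lemma FcoefE l k n N : (n <= N <= k)%N -> Fcoef (l + n) (k - n) (N - n) =
  acoef (l + n) (k - n) (N - n) * (eta ^+ (N - n) / ((N - n)`!)%:R *
    (\prod_(n + N <= j < N + N) (g (k%:R - l%:R) - eta * j%:R))^-1).
Proof.
move=> /andP[lenN leNk]; rewrite /Fcoef [_ * acoef _ _ _]mulrC.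
rewrite -[LHS]mulrA; congr (_ * (_ * _^-1)).
rewrite big_add1 -[(n + N)%N]add0n big_addn /= subnDr big_nat_rev /=.
apply: eq_big_nat => i /andP[_ lti]; rewrite -gB; congr (g _).
rewrite (_ : (k - n - (N - n) = k - N)%N); last lia.
rewrite (_ : (l + n + (N - n) = l + N)%N); last lia.
rewrite natrB // !natrD (_ : (0 + (N - n) - i.+1).+1%:R = (N + N)%:R - (i + (n + N))%:R :> C).
  by rewrite !natrD; ring.
by rewrite -natrB; [congr (_%:R)|]; lia.
Qed.

(** * Composition of the two changes of basis *)

Hypothesis g_neq0 : forall l k n : nat, (1 <= n <= k)%N ->
  K la1 l -> K la2 k -> K la1 (l + n)%N -> K la2 (k - n)%N ->
  g (k%:R - l%:R - n%:R) != 0.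
Hypothesis q_neq0 : forall i, q i != 0.

(* [j <= N] compares (l, k) with (l + j, k - j); for larger [j], compare the
   points of the strip at distances [j - N] and [N] from (l, k). *)
Lemma strip_neq0 l k N j : (N <= k)%N -> K la1 (l + N)%N -> K la2 k ->
  (0 < j < N + N)%N -> g (k%:R - l%:R) - eta * j%:R != 0.
Proof.
move=> leNk KlN Kk jN; rewrite -gB.
have [leNj|ltNj] := leqP j N.
  by apply: g_neq0 => //; [lia|apply: K_le KlN; lia|apply: K_le KlN; lia|apply: K_le Kk; lia].
rewrite (_ : _ - _ = (k - (j - N))%:R - (l + (j - N))%:R - (N + N - j)%:R :> C).
  by apply: g_neq0 => //; [lia|apply: K_le KlN; lia|apply: K_le Kk; lia|apply: K_le KlN; lia|apply: K_le Kk; lia].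
rewrite natrD !natrB ?natrD; [ring|lia..].
Qed.

(** Up to the factors [q], this is the entry of [F12 V] from [(l, k)] to [(l + N, k - N)]. *)
Lemma sum_vcoef_Fcoef l k N : (N <= k)%N -> K la1 (l + N)%N -> K la2 k ->
  \sum_(0 <= n < N.+1) vcoef l k n * Fcoef (l + n) (k - n) (N - n) = (N == 0%N)%:R.
Proof.
move=> leNk KlN Kk; case: (posnP N) => [->|N0].
  rewrite big_nat1 vcoefE // FcoefE // /acoef !big_geq //.
  by rewrite !expr0 fact0 !divr1 !mulr1.
transitivity (acoef l k N * \sum_(0 <= n < N.+1)
    (((- eta) ^+ n / (n`!)%:R *
       (\prod_(1 <= j < n.+1) (g (k%:R - l%:R) - eta * j%:R))^-1) *
     (eta ^+ (N - n) / ((N - n)`!)%:R *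
        (\prod_(n + N <= j < N + N) (g (k%:R - l%:R) - eta * j%:R))^-1))).
  rewrite mulr_sumr; apply: eq_big_nat => n /andP[_ ltnN].
  rewrite vcoefE ?FcoefE; [|lia..].
  (* The [n] steps and the [N - n] further ones combine into [acoef l k N], which is independent of
     [n]. *)
  by rewrite mulrACA -acoefD subnKC.
rewrite sum_alt_fact_prodV // => [|j]; last exact: strip_neq0.
by rewrite mulr0.
Qed.

Lemma F12_vvec i : F12 eta de1 de2 q (vvec eta de1 de2 q i) = << i >>.
Proof.
rewrite vvecE; set l := val i.1; set k := val i.2.
have Kl : K la1 l := valP i.1; have Kk : K la2 k := valP i.2.
rewrite linearZ linear_sum /=.
(* Collect by total shift [N]: [n] steps come from [vvec] and [N - n] from [F12]. *)
transitivity (q i *: Q12 q (\sum_(0 <= N < k.+1)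
   (\sum_(0 <= n < N.+1) vcoef l k n * Fcoef (l + n) (k - n) (N - n))
     *: ket2 la1 la2 (l + N) (k - N))).
  congr (_ *: _).
  transitivity (Q12 q (\sum_(0 <= n < k.+1) \sum_(0 <= N < k.+1 | (n <= N)%N)
     (vcoef l k n * Fcoef (l + n) (k - n) (N - n)) *: ket2 la1 la2 (l + N) (k - N))).
    rewrite [in RHS]/Q12 fglift_sum; apply: eq_big_nat => n /andP[_ ltn].
    rewrite linearZ /= F12_ket2; last by apply: K_le Kk; exact: leq_subr.
    rewrite /Q12 -fgliftZ; congr fglift; rewrite scaler_sumr.
    transitivity (\sum_(n <= N < k.+1)
      (vcoef l k n * Fcoef (l + n) (k - n) (N - n)) *: ket2 la1 la2 (l + N) (k - N));
      last by rewrite (@big_nat_widenl _ _ _ _ 0%N).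
    rewrite [RHS](big_addn 0 k.+1 n) subSn //.
    apply: eq_big_nat => m /andP[_ ltm].
    by rewrite scalerA addnK -subnDA -!addnA [(m + n)%N]addnC.
  congr (Q12 q _); rewrite (exchange_big_dep_nat xpredT) //=.
  apply: eq_big_nat => N /andP[_ ltN]; rewrite scaler_suml.
  by rewrite [RHS](@big_nat_widen _ _ _ _ _ k.+1).
(* Only [N = 0] survives, so [Q12] contributes just [(q i)^-1], which cancels [q i]. *)
rewrite (_ : \sum_(0 <= N < k.+1) _ = << i >>).
  by rewrite /Q12 fgliftU scalerA divff // scale1r.
rewrite big_ltn // addn0 subn0 sum_vcoef_Fcoef //=; last by rewrite addn0.
rewrite scale1r ket2_val.
rewrite big_nat big1 ?addr0 // => N /andP[N0 ltN].
(* Outside [K la1] the denominators are not controlled, but the basis vector is zero. *)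
have [KN|nKN] := boolP (K la1 (l + N)%N); last first.
  by rewrite ket2F ?scaler0 // (negPf nKN).
by rewrite sum_vcoef_Fcoef // eqn0Ngt N0 scale0r.
Qed.

(** Strong induction on [k]: beyond its leading term, [v_{l k}] involves only vectors with second
    index below [k]. *)
Lemma vvec_surj (y : W) : exists x : W, fglift (vvec eta de1 de2 q) x = y.
Proof.
suff ketP k l : exists x : W, fglift (vvec eta de1 de2 q) x = ket2 la1 la2 l k.
  rewrite (freeg_decomp y); elim: (dom y) => [|i r [x ex] ].
    by exists 0; rewrite big_nil fglift0.
  have [z ez] := ketP (val i.2) (val i.1); exists (coeff i y *: z + x).
  by rewrite big_cons fgliftD fgliftZ ez ex ket2_val.
elim/ltn_ind: k l => k IH l.
have [/andP[Kl Kk]|nK] := boolP (K la1 l && K la2 k); last first.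
  by exists 0; rewrite fglift0 ket2F.
have [x ex] : exists x : W, fglift (vvec eta de1 de2 q) x =
    \sum_(1 <= n < k.+1) vcoef l k n *: ket2 la1 la2 (l + n) (k - n).
  rewrite big_nat; elim/big_rec: _ => [|n s /andP[n0 ltn] [x <-]].
    by exists 0; rewrite fglift0.
  have [|z ez] := IH (k - n)%N _ (l + n)%N; first lia.
  by exists (vcoef l k n *: z + x); rewrite fgliftD fgliftZ ez.
pose i : idx la1 * idx la2 := (exist _ l Kl, exist _ k Kk).
(* Dividing [v_{l k}] by [q i] gives [|l, k>] plus the tail whose preimage is [x]. *)
exists ((q i)^-1 *: << i >> - x).
rewrite linearB /= fgliftZ fgliftU vvecE scalerA mulVf // scale1r ex big_ltn //=.
by rewrite addrK /vcoef big_geq // fact0 expr0 divr1 mulr1 scale1r addn0 subn0.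
Qed.

Lemma vvecK : cancel (fglift (vvec eta de1 de2 q)) (F12 eta de1 de2 q).
Proof.
move=> x; rewrite (freeg_decomp x) !linear_sum; apply: eq_bigr => i _.
by rewrite /= fgliftZ linearZ /= fgliftU F12_vvec.
Qed.

Lemma F12K : cancel (F12 eta de1 de2 q) (fglift (vvec eta de1 de2 q)).
Proof. by move=> y; have [x <-] := vvec_surj y; rewrite vvecK. Qed.

(** * Diagonalization of [DeltaD] *)

Definition Deigen u l k : C :=
  (u - de1 - eta * (la1 - l%:R)) * (u - de2 - eta * (la2 - k%:R)).

Lemma evD_ket la de u k :
  evD eta de u (ket la k) = (u - de - eta * (la - k%:R)) *: ket la k.
Proof.
have [Kk|nKk] := boolP (K la k); last first.
  by rewrite ketF // /evD /opH fglift0 !scaler0 !subr0.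
by rewrite /evD /opH ketT fgliftU /= ketT scalerA -!scalerBl.
Qed.

Lemma DeltaD_linear u : linear (DeltaD eta de1 de2 u : W -> W).
Proof.
move=> c x y; rewrite /DeltaD /otimes !fgliftD !fgliftZ.
by rewrite addrACA -scalerDr.
Qed.

HB.instance Definition _ u := GRing.isLinear.Build C W W *:%R
  (DeltaD eta de1 de2 u) (DeltaD_linear u).

(** [B (x) C] moves one step along the strip, while [D (x) D] is diagonal with eigenvalue
    [Deigen u l k]. *)
Lemma DeltaD_ket2 u l k : K la2 k ->
  DeltaD eta de1 de2 u (ket2 la1 la2 l k) =
  (eta ^+ 2 * (fcoef la1 l * ecoef R k)) *: ket2 la1 la2 l.+1 k.-1
  + Deigen u l k *: ket2 la1 la2 l k.
Proof.
move=> Kk; have [Kl|nKl] := boolP (K la1 l); last first.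
  rewrite ket2F ?(negPf nKl) // ket2F ?linear0 ?scaler0 ?addr0 //.
  by rewrite negb_and; apply/orP; left; apply: contra nKl; apply: K_le.
rewrite /DeltaD !otimes_ket2 // /evB /evC opF_ket opE_ket // !scalerA.
rewrite !evD_ket !tens_scale; congr (_ *: _ + _).
by rewrite expr2 mulrACA.
Qed.

Lemma vcoefS l k n : vcoef l k n.+1 = vcoef l k n *
  (- eta / n.+1%:R *
    (fcoef la1 (l + n) * ecoef R (k - n.+1 + 1) / g (k%:R - l%:R - n.+1%:R))).
Proof.
rewrite /vcoef big_nat_recr //= factS natrM exprSr invfM addnS subn1 /=.
by rewrite [RHS]mulrACA; congr (_ * _); rewrite [RHS]mulrACA [_^-1 * _]mulrC.
Qed.

(** With [a] and [b] the two factors of [Deigen u l k], [n] steps give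
    [(a + eta * n) * (b - eta * n)], and [b - a = g (k - l)] is free of [u]. *)
Lemma DeigenD u l k n : (n <= k)%N -> Deigen u (l + n) (k - n) =
  Deigen u l k + eta * n%:R * g (k%:R - l%:R - n%:R).
Proof. by move=> lenk; rewrite /Deigen /Defs.g natrB // natrD; ring. Qed.

(* With c_n the coefficients of v_{l k}, the eigenvalue equation amounts to the
   recurrence eta^2 f e c_n = - eta (n + 1) g(k - l - (n + 1)) c_{n+1}. *)
Lemma DeltaD_vvec u i : DeltaD eta de1 de2 u (vvec eta de1 de2 q i) =
  Deigen u (val i.1) (val i.2) *: vvec eta de1 de2 q i.
Proof.
rewrite vvecE; set l := val i.1; set k := val i.2.
have Kk : K la2 k := valP i.2.
rewrite linearZ scalerA mulrC -scalerA linear_sum /=; congr (_ *: _).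
under eq_bigr => n _.
  rewrite linearZ /= DeltaD_ket2; last by apply: K_le Kk; exact: leq_subr.
  rewrite scalerDr !scalerA; over.
(* The term [n = k] of the [B (x) C] part carries [ecoef 0 = 0]; the others pair with the diagonal
   terms of index [n + 1]. *)
rewrite big_split /= big_nat_recr //= subnn /ecoef !mulr0 scale0r addr0.
rewrite [X in _ + X]big_nat_recl // addrCA -big_split /= addn0 subn0.
rewrite scaler_sumr big_nat_recl // addn0 subn0 scalerA [vcoef l k 0 * _]mulrC.
congr (_ + _); apply: eq_big_nat => n /andP[_ ltnk].
rewrite -subnS -addnS scalerA -scalerDl.
have [Kln|nK] := boolP (K la1 (l + n.+1)%N); last by rewrite ket2F ?(negPf nK) // !scaler0.
congr (_ *: _).
have g0 : g (k%:R - l%:R - n.+1%:R) != 0.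
  by apply: g_neq0 => //; [apply: K_le Kln; lia|apply: K_le Kk; lia].
have n0 : n.+1%:R != 0 :> C by rewrite pnatr_eq0.
rewrite DeigenD // vcoefS (_ : (k - n.+1 + 1 = k - n)%N); last lia.
rewrite -/(ecoef R _).
move: (g _) g0 => G G0; move: (n.+1%:R : C) n0 => m m0.
by field; rewrite G0 m0.
Qed.

(** The basis property comes from the inversion: [F12] itself is the two-sided inverse. *)
Lemma diagonalizes_vvec u :
  diagonalizes (vvec eta de1 de2 q) (DeltaD eta de1 de2 u).
Proof.
split; last by move=> i; exists (Deigen u (val i.1) (val i.2)); exact: DeltaD_vvec.
by exists (F12 eta de1 de2 q); [exact: vvecK|exact: F12K].
Qed.

End Kets.

Theorem proposition3p14 (R : realType) (eta la1 la2 de1 de2 : R[i])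
    (eta_neq0 : eta != 0)
    (g_neq0 : forall l k n : nat, (1 <= n <= k)%N ->
       K la1 l -> K la2 k -> K la1 (l + n)%N -> K la2 (k - n)%N ->
       g eta la1 la2 de1 de2 (k%:R - l%:R - n%:R) != 0)
    (q : idx la1 * idx la2 -> R[i])
    (q_neq0 : forall i, q i != 0) :
  let v := vvec eta de1 de2 q in
  (forall u : R[i], diagonalizes v (@DeltaD R eta la1 la2 de1 de2 u))
  /\ cancel (fglift v) (F12 eta de1 de2 q)
  /\ cancel (F12 eta de1 de2 q) (fglift v).
Proof.
split; first by move=> u; exact: diagonalizes_vvec.
by split; [exact: vvecK|exact: F12K].
Qed.
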